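(* Let $0<\alpha<2$ and let $n\ge 0$ be an integer. Then for all $x\in\mathbb{R}$, $$(-\Delta)^{\alpha/2}\widetilde{H}_{2n}(x)=2^{\alpha}\,\frac{(-1)^{n}\sqrt{(2n)!}}{2^{n}\,n!}\,\frac{\Gamma\left(n+\frac{\alpha}{2}+\frac12\right)}{\Gamma\left(n+\frac12\right)}\;{}_1F_1\left(n+\frac{\alpha}{2}+\frac12,\ \frac12;\ -x^2\right).$$
   Context: The Hermite polynomials are defined by $H_0(x)=1$, $H_1(x)=2x$, $H_{n+1}(x)=2xH_n(x)-2nH_{n-1}(x)$ for $n\ge1$. The over-scaled Hermite functions are $$\widetilde{H}_n(x)=\frac{1}{\sqrt{2^n n!}}\,e^{-x^2}H_n(x),\qquad x\in\mathbb{R}.$$ The confluent hypergeometric function is ${}_1F_1(a,b;x)=\sum_{k=0}^\infty \frac{(a)_k}{(b)_k}\frac{x^k}{k!}$, where $(a)_0=1$ and $(a)_k=a(a+1)\cdots(a+k-1)$. The fractional Laplacian on $\mathbb{R}$ is defined via the Fourier transform by $\mathcal{F}[(-\Delta)^{\alpha/2}u](\xi)=|\xi|^\alpha\,\mathcal{F}[u](\xi)$, where $\mathcal{F}[u](\xi)=\frac{1}{\sqrt{2\pi}}\int_{\mathbb{R}}u(x)e^{-\mathrm{i}x\xi}\,dx$; that is, $(-\Delta)^{\alpha/2}u(x)=\frac{1}{\sqrt{2\pi}}\int_{\mathbb{R}}|\xi|^\alpha\mathcal{F}[u](\xi)e^{\mathrm{i}x\xi}\,d\xi$. *)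

(* Defs.v *)
From mathcomp Require Export all_boot all_order all_algebra.
From mathcomp Require Export all_classical all_reals all_analysis.
From mathcomp Require Export complex.
Set Implicit Arguments.
Unset Strict Implicit.
Unset Printing Implicit Defensive.
Import Order.TTheory GRing.Theory Num.Theory numFieldNormedType.Exports.

Local Open Scope classical_set_scope.
Local Open Scope ring_scope.
Local Open Scope complex_scope.

(* Physicists' Hermite polynomials; the last clause is the recurrence
   H_{m+1} = 2x H_m - 2m H_{m-1} at m = k.+1. *)
Fixpoint hermite (R : realType) (n : nat) : {poly R} :=
  match n with
  | 0 => 1
  | 1 => 2%:P * 'X
  | (k.+1 as m).+1 => 2%:P * 'X * hermite R m - (2 * m%:R)%:P * hermite R k
  end.

Definition overscaled_hermite (R : realType) (n : nat) (x : R) : R :=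
  (Num.sqrt (2 ^+ n * n`!%:R))^-1 * expR (- x ^+ 2) * (hermite R n).[x].

(* The factor (a)_k, not to be confused with the falling factorial n ^_ k. *)
Definition rising_factorial (R : realType) (a : R) (k : nat) : R :=
  \prod_(i < k) (a + i%:R).

Definition hypergeometric_1F1 (R : realType) (a b x : R) : R :=
  limn (series (fun k : nat =>
    rising_factorial a k / rising_factorial b k * (x ^+ k / k`!%:R))).

(* Euler's integral, which represents the Gamma function for s > 0 only. *)
Definition Gamma (R : realType) (s : R) : R :=
  \int[@lebesgue_measure R]_(t in `]0, +oo[) (t `^ (s - 1) * expR (- t)).

(* Lebesgue integral over the real line of a complex-valued function.  Like
   Rintegral, it is only meaningful when both components are integrable. *)
Definition Cintegral (R : realType) (f : R -> R[i]) : R[i] :=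
  (\int[@lebesgue_measure R]_x complex.Re (f x)) +i*
  (\int[@lebesgue_measure R]_x complex.Im (f x)).

(* exp (i t) for real t *)
Definition cis (R : realType) (t : R) : R[i] := cos t +i* sin t.

Definition fourier (R : realType) (u : R -> R[i]) (xi : R) : R[i] :=
  ((Num.sqrt (2 * pi))^-1)%:C * Cintegral (fun x : R => u x * cis (- (x * xi))).

(* (-Delta)^(alpha/2) u, as the inverse Fourier transform of
   |xi|^alpha F[u](xi). *)
Definition fractional_laplacian (R : realType) (alpha : R) (u : R -> R[i])
    (x : R) : R[i] :=
  ((Num.sqrt (2 * pi))^-1)%:C *
  Cintegral (fun xi : R => (`|xi| `^ alpha)%:C * fourier u xi * cis (x * xi)).

(* Main.v *)
(* The functions e^(-y^2) H_n(y) satisfy (e^(-y^2) H_n)' = - e^(-y^2) H_(n+1), so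
   integrating by parts twice against cos (xi y) multiplies the integral by
   - xi^2: the Fourier transform of e^(-y^2) H_2n(y) is (-1)^n xi^(2n) times that
   of the Gaussian.  The fractional Laplacian is then a multiple of the integral
   of |xi|^(alpha + 2n) e^(-xi^2/4) cos (x xi).  Expanding the cosine in power
   series under the integral sign, each term is an absolute Gaussian moment, i.e.
   a Gamma value after the substitution u = c t^2, and the functional equation of
   Gamma turns the resulting series into 1F1.  With exponent 0 the same expansion
   gives the Fourier transform of the Gaussian. *)
Require Import Defs.
From mathcomp Require Import measurable_realfun ring lra.
Set Implicit Arguments.
Unset Strict Implicit.
Unset Printing Implicit Defensive.
Import Order.TTheory GRing.Theory Num.Theory numFieldNormedType.Exports.
Local Open Scope classical_set_scope.
Local Open Scope ring_scope.
Local Open Scope complex_scope.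

Section overscaled_hermite_functions.
Context {R : realType}.
Local Notation mu := (@lebesgue_measure R).

(** * Improper integrals as limits over compact intervals *)

Lemma is_derive1_continuous (f : R -> R) (x d : R) :
  is_derive x 1 f d -> {for x, continuous f}.
Proof. by case=> dx _; exact/differentiable_continuous/derivable1_diffP. Qed.

(** Dominated convergence for the restrictions of [f] to [[a n, b n]], with [|f|] as the bound.
    Asking only that each point of [D] be eventually covered serves the half-line and the whole line
    alike. *)
Lemma Rintegral_itv_exhaustion (D : set R) (a b : nat -> R) (f : R -> R) :
  measurable D -> mu.-integrable D (EFin \o f) ->
  (forall n, `[a n, b n]%classic `<=` D) ->
  (forall x, D x -> \forall n \near \oo, a n <= x <= b n) ->
  \int[mu]_(x in `[a n, b n]) f x @[n --> \oo] --> \int[mu]_(x in D) f x.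
Proof.
move=> mD fi abD Dab.
have mf := measurable_int _ fi.
pose g n := EFin \o (f \_ `[a n, b n]).
have [] := @dominated_convergence _ _ _ mu D mD g (EFin \o f) (abse \o (EFin \o f)).
- move=> n; apply/measurable_EFinP/(measurable_restrict f _ mD) => //=.
  by apply/measurable_EFinP; apply: measurable_funS mf => // x [].
- exact: mf.
- apply: aeW => x Dx; apply: cvg_near_cst.
  near=> n; rewrite /g /= patchE ifT//; apply/mem_set; rewrite /= in_itv/=.
  by near: n; exact: Dab.
- exact: integrable_abse.
- apply: aeW => x n Dx; rewrite /g /= patchE lee_fin; case: ifPn => // _.
  by rewrite normr0.
move=> _ _ cvg_int.
rewrite (_ : (fun n => _) = fun n => \int[mu]_(x in D) (f \_ `[a n, b n]) x).
  by apply: fine_cvg; rewrite fineK//; exact: integrable_fin_num.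
by apply/funext => n; rewrite -Rintegral_mkcondr setIidr.
Unshelve. all: by end_near. Qed.

(** Each integration by parts below goes through this: [F] is the product being differentiated and
    [l] the limit of the boundary terms. It is applied on the open half-line for the functional
    equation of [Gamma], and on the whole line for the Hermite functions. *)
Lemma Rintegral_FTC_exhaustion (D : set R) (a b : nat -> R) (F f : R -> R) (l : R) :
  measurable D -> mu.-integrable D (EFin \o f) ->
  (forall n, a n < b n) ->
  (forall n, `[a n, b n]%classic `<=` D) ->
  (forall x, D x -> \forall n \near \oo, a n <= x <= b n) ->
  (forall x, D x -> {for x, continuous f}) ->
  (forall x, D x -> is_derive x 1 F (f x)) ->
  F (b n) - F (a n) @[n --> \oo] --> l ->
  \int[mu]_(x in D) f x = l.
Proof.
move=> mD fi ltab abD Dab cf dF Fl.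
apply: (cvg_unique _ (Rintegral_itv_exhaustion mD fi abD Dab)) => //.
apply: cvg_trans Fl; apply: near_eq_cvg; near=> n.
rewrite /Rintegral (@continuous_FTC2 _ f F)//.
- apply: continuous_in_subspaceT => x; rewrite inE => /abD; exact: cf.
- have cF x : D x -> {for x, continuous F}.
    by move=> /dF; exact: is_derive1_continuous.
  split.
  + move=> x xab; have [] // : is_derive x 1 F (f x).
    by apply: dF; apply: (abD n); exact: subset_itv_oo_cc.
  + by apply: cvg_at_right_filter; apply/cF/(abD n); rewrite /= in_itv/= lexx ltW.
  + by apply: cvg_at_left_filter; apply/cF/(abD n); rewrite /= in_itv/= lexx ltW.
- move=> x xab; rewrite derive1E; have [] // : is_derive x 1 F (f x).
  by apply: dF; apply: (abD n); exact: subset_itv_oo_cc.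
Unshelve. all: by end_near. Qed.

(** On each [[-n, n]] the reflection [x -> -x] shows that the integral equals its own opposite. *)
Lemma Rintegral_odd (f : R -> R) : mu.-integrable setT (EFin \o f) ->
  continuous f -> (forall x, f (- x) = - f x) -> \int[mu]_x f x = 0.
Proof.
move=> fi cf fN.
have natdom (x : R) : \forall n \near \oo, - n%:R <= x <= n%:R.
  near=> n; rewrite -ler_norml; near: n; exact: nbhs_infty_ger.
apply: (cvg_unique _ (@Rintegral_itv_exhaustion setT (fun n => - n%:R)
  (fun n => n%:R) f _ fi _ _)) => //.
rewrite (_ : (fun n : nat => _) = cst 0) ?lim_cst//; first exact: cvg_cst.
apply/funext => n /=.
suff : \int[mu]_(x in `[- n%:R, n%:R]) f x = - \int[mu]_(x in `[- n%:R, n%:R]) f x.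
  by move/eqP; rewrite -subr_eq0 opprK -mulr2n mulrn_eq0 => /eqP.
have sfi : mu.-integrable `[- n%:R, n%:R] (EFin \o f).
  exact: (integrableS measurableT).
have := @integration_by_substitution_oppr R f (- n%:R) n%:R.
rewrite opprK => /(_ _ _) intN.
rewrite -[RHS]mulN1r -RintegralZl// /Rintegral intN; last 2 first.
- by rewrite ge0_cp.
- exact: continuous_subspaceT.
by congr fine; apply: eq_integral => x _ /=; rewrite fN mulN1r.
Unshelve. all: by end_near. Qed.

(** * Absolute Gaussian moments and the Gamma function *)

Definition gauss_weight (s c t : R) : R := `|t| `^ s * expR (- (c * t ^+ 2)).

Lemma gauss_weight_ge0 s c t : 0 <= gauss_weight s c t.
Proof. by rewrite mulr_ge0 ?powR_ge0 ?expR_ge0. Qed.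

Lemma gauss_weightN s c t : gauss_weight s c (- t) = gauss_weight s c t.
Proof. by rewrite /gauss_weight normrN sqrrN. Qed.

Lemma continuous_norm_powR (s : R) : 0 <= s ->
  continuous (fun t : R => `|t| `^ s).
Proof.
rewrite le_eqVlt => /predU1P[<- t|s0 t].
  under eq_fun do rewrite powRr0; exact: cvg_cst.
have lim0 : `|y| `^ s @[y --> (0 : R)] --> (0 : R).
  apply/cvgrPdist_lt => e e0.
  have es0 : 0 < e `^ s^-1 by rewrite powR_gt0.
  have eE : (e `^ s^-1) `^ s = e by rewrite -powRrM mulVf ?gt_eqF// powRr1// ltW.
  near=> y.
  have ye : `|y| < e `^ s^-1.
    by near: y; exact: (@pseudometric_normed_Zmodule.nbhs0_lt R R^o _ es0).
  rewrite sub0r normrN ger0_norm ?powR_ge0// -[ltRHS]eE.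
  by rewrite gt0_ltr_powR// ?nnegrE ?powR_ge0.
have [->|t0] := eqVneq t 0.
  by rewrite /continuous_at normr0 powR0 ?gt_eqF.
apply: (@continuous_comp _ _ _ (fun t : R => `|t|) (fun u => u `^ s)).
  exact: norm_continuous.
apply/differentiable_continuous/derivable1_diffP; apply: derivable_powR.
by rewrite in_itv/= andbT normr_gt0.
Unshelve. all: by end_near. Qed.

Lemma continuous_gauss_weight s c : 0 <= s -> continuous (gauss_weight s c).
Proof.
move=> s0 t; apply: cvgM; first exact: continuous_norm_powR.
apply: (cvg_comp (fun t => - (c * t ^+ 2)) expR); last exact: continuous_expR.
apply: cvgN; apply: cvgMr; exact: exprn_continuous.
Qed.

Let bigcup_itv_pos (a b : nat -> R) : (forall n, 0 < a n) ->
    a n @[n --> \oo] --> 0 -> b n @[n --> \oo] --> +oo ->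
  \bigcup_n `[a n, b n]%classic = `]0, +oo[%classic.
Proof.
move=> a0 al bl; apply/seteqP; split => [x [n _]/=|x /=].
  by rewrite !in_itv/= andbT => /andP[+ _]; apply: lt_le_trans.
rewrite in_itv/= andbT => x0.
have [n _ /(_ n (leqnn n))nx] : \forall n \near \oo, a n <= x <= b n.
  near=> n; apply/andP; split; near: n; last exact: (cvgry_ge bl).
  exact: (cvgr_le _ al).
by exists n.
Unshelve. all: by end_near. Qed.

(** Monotone convergence along increasing intervals. Being stated in the extended reals, it applies
    before anything is known to be integrable. *)
Lemma ge0_integral_pos_exhaustion (a b : nat -> R) (f : R -> R) :
  (forall n, 0 < a n) -> (forall n m, (n <= m)%N -> a m <= a n) ->
  (forall n m, (n <= m)%N -> b n <= b m) ->
  a n @[n --> \oo] --> 0 -> b n @[n --> \oo] --> +oo ->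
  (forall x, 0 < x -> 0 <= f x) -> (forall x, 0 < x -> {for x, continuous f}) ->
  (\int[mu]_(x in `[a n, b n]) (f x)%:E @[n --> \oo] -->
   \int[mu]_(x in `]0%R, +oo[) (f x)%:E)%E.
Proof.
move=> a0 a_dec b_inc al bl f0 cf.
have abpos n x : x \in `[a n, b n] -> 0 < x.
  by rewrite in_itv/= => /andP[+ _]; exact: lt_le_trans.
rewrite -(bigcup_itv_pos a0 al bl); apply: ge0_nondecreasing_set_cvg_integral.
- move=> n m nm; rewrite subsetEset => x /=; rewrite !in_itv/= => /andP[ax xb].
  by rewrite (le_trans (a_dec _ _ nm) ax) (le_trans xb (b_inc _ _ nm)).
- by move=> n; exact: measurable_itv.
- move=> n; apply/measurable_EFinP.
  have mf : measurable_fun (`](0 : R), +oo[%classic : set R) f.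
    apply: open_continuous_measurable_fun; first exact: interval_open.
    by move=> x /[!inE]/=; rewrite in_itv/= andbT; exact: cf.
  apply: measurable_funS mf => // x /= /abpos.
  by rewrite in_itv/= andbT.
- by move=> n x /abpos /f0; rewrite lee_fin.
Qed.

(* The library's substitution on half-lines does not apply: g may be singular at
   0, and the derivative of c t^2 has no limit at infinity. *)
Lemma integral_substitution_scaled_square (c : R) (g : R -> R) : 0 < c ->
  (forall u, 0 < u -> 0 <= g u) -> (forall u, 0 < u -> {for u, continuous g}) ->
  (\int[mu]_(u in `]0%R, +oo[) (g u)%:E =
   \int[mu]_(t in `]0%R, +oo[) (g (c * t ^+ 2) * (2 * c * t))%:E)%E.
Proof.
move=> c0 g0 cg.
pose a n : R := n.+1%:R^-1; pose b n : R := n.+1%:R.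
pose F t : R := c * t ^+ 2.
have a0 n : 0 < a n by rewrite invr_gt0.
have b0 n : 0 < b n by [].
have F0 t : 0 < t -> 0 < F t by move=> t0; rewrite /F mulr_gt0// exprn_gt0.
have incF : {in Num.pos &, {homo F : x y / x < y}}.
  move=> x y; rewrite !posrE => x0 y0 xy; rewrite /F ltr_pM2l//.
  by rewrite ltr_pXn2r// nnegrE ltW.
have lF : {in Num.pos &, {homo F : x y / x <= y}}.
  by move=> x y x0 y0; rewrite le_eqVlt => /predU1P[->//|xy]; exact/ltW/incF.
have ab n : a n <= b n.
  by rewrite (@le_trans _ _ 1)// ?invf_le1// ler1n.
have a_dec n m : (n <= m)%N -> a m <= a n.
  by move=> nm; rewrite lef_pV2 ?posrE// ler_nat.
have b_inc n m : (n <= m)%N -> b n <= b m by move=> nm; rewrite ler_nat.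
have a_lim : a n @[n --> \oo] --> 0 by exact: cvg_harmonic.
have b_lim : b n @[n --> \oo] --> +oo.
  by rewrite (cvg_shiftS (fun n => n%:R : R)); exact: cvgr_idn.
have dF (t : R) : is_derive t 1 F (2 * c * t).
  by apply: is_derive_eq; rewrite /GRing.scale/=; ring.
have F'E : F^`()%classic = fun t => 2 * c * t.
  by apply/funext => t; rewrite derive1E; have [] := dF t.
have cF : continuous F.
  by move=> t; exact: is_derive1_continuous (dF t).
have cF' : continuous F^`()%classic by rewrite F'E => t; exact: mulrl_continuous.
have ap n : a n \in Num.pos by rewrite posrE.
have bp n : b n \in Num.pos by rewrite posrE.
have itv_pos n x : x \in `[a n, b n] -> 0 < x.
  by rewrite in_itv/= => /andP[+ _]; exact: lt_le_trans.
have Fitv_pos n x : x \in `[F (a n), F (b n)] -> 0 < x.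
  by rewrite in_itv/= => /andP[+ _]; apply: lt_le_trans; exact: F0.
have eq_n n : (\int[mu]_(u in `[F (a n), F (b n)]) (g u)%:E =
    \int[mu]_(t in `[a n, b n]) (g (c * t ^+ 2) * (2 * c * t))%:E)%E.
  rewrite (@integration_by_substitution_increasing _ F g)//.
  - by apply: eq_integral => x _; rewrite /= F'E.
  - by move=> x y xab yab; apply: incF; rewrite posrE; exact: (itv_pos n).
  - by apply: cvgP; exact: cvg_at_right_filter (cF' _).
  - by apply: cvgP; exact: cvg_at_left_filter (cF' _).
  - split; first by move=> x _; have [] := dF x.
    + exact: cvg_at_right_filter (cF _).
    + exact: cvg_at_left_filter (cF _).
  - by apply: continuous_in_subspaceT => x /[!inE] /(Fitv_pos n); exact: cg.
have Fa_lim : F (a n) @[n --> \oo] --> 0.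
  rewrite (_ : 0 = F 0); last by rewrite /F expr0n mulr0.
  exact: (cvg_comp a F a_lim (cF 0)).
have Fb_lim : F (b n) @[n --> \oo] --> +oo.
  by apply: (cvg_comp b F b_lim); apply: gt0_cvgMry => //; exact: cvgr_expr2.
apply: (cvg_unique _ (ge0_integral_pos_exhaustion _ _ _ Fa_lim Fb_lim g0 cg)) => //.
- by move=> n; exact: F0.
- by move=> n m nm; apply: lF => //; exact: a_dec.
- by move=> n m nm; apply: lF => //; exact: b_inc.
rewrite /= (eq_cvg _ _ eq_n).
apply: ge0_integral_pos_exhaustion => //.
- by move=> t t0; rewrite mulr_ge0 ?g0// ?F0// !mulr_ge0 ?ltW.
- move=> t t0; apply: cvgM; last exact: mulrl_continuous.
  by apply: (cvg_comp F g (cF t)); exact/cg/F0.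
Qed.

Lemma measurable_gauss_weight s c :
  measurable_fun [set: R] (gauss_weight s c).
Proof.
apply: measurable_funM; first by apply: (measurableT_comp (measurable_powR s)).
apply: (measurableT_comp (@measurable_expR R)).
by apply: measurable_funN; apply: measurable_funM.
Qed.

Definition Gamma_integrand (p t : R) : R := t `^ (p - 1) * expR (- t).

Lemma Gamma_integrand_ge0 p t : 0 <= Gamma_integrand p t.
Proof. by rewrite mulr_ge0 ?powR_ge0 ?expR_ge0. Qed.

Lemma measurable_Gamma_integrand p : measurable_fun [set: R] (Gamma_integrand p).
Proof. by apply: measurable_funM => //; exact: measurableT_comp. Qed.

Lemma is_derive_powRM_expRN (p t : R) : 0 < t ->
  is_derive t 1 (fun t => t `^ p * expR (- t))
    (p * Gamma_integrand p t - Gamma_integrand (p + 1) t).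
Proof.
move=> t0; have dp := is_derive1_powR p t0.
apply: is_derive_eq; rewrite /GRing.scale/= /Gamma_integrand addrK; ring.
Qed.

Lemma continuous_Gamma_integrand p t : 0 < t ->
  {for t, continuous (Gamma_integrand p)}.
Proof.
by move=> t0; exact: is_derive1_continuous (is_derive_powRM_expRN (p - 1) t0).
Qed.

(** Evenness reduces the integral to twice the half-line, where [u = c t^2] produces the Gamma
    integrand. The identity lives in the extended reals because integrability of both sides is later
    deduced from it. *)
Lemma integral_gauss_weight (s c : R) : 0 <= s -> 0 < c ->
  (\int[mu]_t (gauss_weight s c t)%:E =
   (c `^ (- ((s + 1) / 2)))%:E *
   \int[mu]_(t in `]0%R, +oo[) (Gamma_integrand ((s + 1) / 2) t)%:E)%E.
Proof.
move=> s0 c0; set p := (s + 1) / 2.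
have cw := @continuous_gauss_weight s c s0.
have cN0 : c != 0 by rewrite gt_eqF.
(* The factor 2 comes from evenness and [2 * c * t] is the Jacobian; the powers of [t] agree since
   [2 (p - 1) + 1 = s]. *)
have scaled (t : R) : 0 < t -> 2 * gauss_weight s c t =
    c `^ (- p) * (Gamma_integrand p (c * t ^+ 2) * (2 * c * t)).
  move=> t0; have tN0 : t != 0 by rewrite gt_eqF.
  have c_p : c `^ p = c `^ (p - 1) * c.
    by rewrite -[X in _ * X](powRr1 (ltW c0)) -powRD ?subrK// cN0 implybT.
  have t_s : t `^ s = (t ^+ 2) `^ (p - 1) * t.
    rewrite -powR_mulrn ?ltW// -powRrM -[X in _ * X](powRr1 (ltW t0)).
    by rewrite -powRD ?tN0 ?implybT//; congr (_ `^ _); rewrite /p; field.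
  rewrite /gauss_weight /Gamma_integrand (gtr0_norm t0) powRM ?exprn_ge0 ?ltW//.
  rewrite powRN c_p t_s.
  have cp0 : c `^ (p - 1) != 0 by rewrite gt_eqF ?powR_gt0.
  by field; rewrite cp0 cN0.
rewrite ge0_symfun_integralT//; last 2 first.
- by move=> t; exact: gauss_weight_ge0.
- by move=> t /=; rewrite gauss_weightN.
rewrite (_ : [set x : R | 0 <= x] = `[0, +oo[%classic); last first.
  by apply/seteqP; split => x /=; rewrite in_itv/= andbT.
have mw D : measurable_fun D (fun t => (gauss_weight s c t)%:E).
  by apply/measurable_EFinP/measurable_funTS; exact: measurable_gauss_weight.
rewrite -integral_itv_obnd_cbnd// (@integral_substitution_scaled_square c)//; last 2 first.
- by move=> u _; exact: Gamma_integrand_ge0.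
- by move=> u; exact: continuous_Gamma_integrand.
rewrite -!ge0_integralZl_EFin//=; last 5 first.
- move=> t; rewrite in_itv/= andbT => t0; rewrite lee_fin.
  by rewrite mulr_ge0 ?Gamma_integrand_ge0// !mulr_ge0 ?ltW.
- apply/measurable_EFinP/measurable_funTS; apply: measurable_funM => //.
  apply: measurableT_comp; first exact: measurable_Gamma_integrand.
  exact: measurable_funM.
- exact: powR_ge0.
- by move=> t _; rewrite lee_fin gauss_weight_ge0.
- exact: mw.
apply: eq_integral => t; rewrite inE/= in_itv/= andbT => t0.
by rewrite -!EFinM scaled.
Qed.

Let p_half : (0 + 1) / 2 = 2^-1 :> R. Proof. by rewrite add0r mul1r. Qed.

(** The moment formula at [s = 0], [c = 1], read from right to left against the known Gaussian
    integral. *)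
Lemma integral_Gamma_integrand_half :
  (\int[mu]_(t in `]0%R, +oo[) (Gamma_integrand 2^-1 t)%:E = (Num.sqrt pi)%:E)%E.
Proof.
have := @integral_gauss_weight 0 1 (lexx _) ltr01.
rewrite p_half powR1 mul1e => <-; rewrite -integralT_gauss.
by apply: eq_integral => t _; rewrite /gauss_weight powRr0 !mul1r.
Qed.

Lemma exprn_le_fact_expR n (u : R) : 0 <= u -> u ^+ n <= n`!%:R * expR u.
Proof.
move=> u0; case: n => [|n].
  by rewrite expr0 mul1r -expR0 ler_expR.
have f0 : 0 < n.+1`!%:R :> R by rewrite ltr0n fact_gt0.
rewrite mulrC -ler_pdivrMr//; apply: le_trans (expR_ge1Dxn n u0).
by rewrite lerDr.
Qed.

(** With an integer [m >= s], the power is at most [|t|^(2m)] when [|t| >= 1], and [(c t^2)^m] is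
    bounded by [m!] times the exponential. The summand 1 in the constant takes care of
    [|t| <= 1]. *)
Lemma norm_powR_le_expR_sqr (s c : R) : 0 <= s -> 0 < c ->
  exists2 K : R, 0 <= K & forall t : R, `|t| `^ s <= K * expR (c * t ^+ 2).
Proof.
move=> s0 c0; pose m := Num.bound s.
exists (1 + m`!%:R * c ^- m); first by rewrite addr_ge0// mulr_ge0// invr_ge0 exprn_ge0 ?ltW.
move=> t; have e1 : 1 <= expR (c * t ^+ 2).
  by rewrite -expR0 ler_expR mulr_ge0 ?sqr_ge0 ?ltW.
have [t1|/ltW t1] := leP `|t| 1.
  apply: (@le_trans _ _ 1).
    by have := @ge0_ler_powR R s s0 `|t| 1; rewrite powR1 !nnegrE; apply.
  by rewrite mulrDl mul1r (le_trans e1)// lerDl !mulr_ge0 ?expR_ge0 ?invr_ge0 ?exprn_ge0 ?ltW.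
have sm : s <= (2 * m)%:R.
  rewrite (@le_trans _ _ m%:R) ?ler_nat ?leq_pmull//.
  exact/ltW/archi_boundP.
apply: (le_trans (ler_powR t1 sm)).
rewrite powR_mulrn// exprM real_normK ?num_real// mulrDl.
apply: le_trans (_ : m`!%:R * c ^- m * expR (c * t ^+ 2) <= _); last first.
  by rewrite lerDr mul1r expR_ge0.
rewrite mulrAC ler_pdivlMr ?exprn_gt0// mulrC -exprMn.
by apply: exprn_le_fact_expR; rewrite mulr_ge0 ?sqr_ge0 ?ltW.
Qed.

(** Half of the Gaussian decay absorbs the power of [|t|]; the other half is a pure Gaussian, whose
    integral is finite by the case [s = 0]. *)
Lemma integrable_gauss_weight (s c : R) : 0 <= s -> 0 < c ->
  mu.-integrable setT (EFin \o gauss_weight s c).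
Proof.
move=> s0 c0.
have c20 : 0 < c / 2 by rewrite divr_gt0.
have i0 : mu.-integrable setT (EFin \o gauss_weight 0 (c / 2)).
  apply/integrableP; split; first by apply/measurable_EFinP; exact: measurable_gauss_weight.
  under eq_integral do rewrite gee0_abs ?lee_fin ?gauss_weight_ge0//.
  rewrite integral_gauss_weight// p_half integral_Gamma_integrand_half -EFinM.
  exact: ltry.
have [K K0 sK] := norm_powR_le_expR_sqr s0 c20.
apply: (le_integrable _ _ _ (integrableZl _ K i0)) => //.
  by apply/measurable_EFinP; exact: measurable_gauss_weight.
move=> t _ /=; rewrite lee_fin !ger0_norm ?mulr_ge0 ?gauss_weight_ge0//.
rewrite /gauss_weight powRr0 mul1r.
apply: le_trans (ler_wpM2r (expR_ge0 _) (sK t)) _.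
have e2 (u : R) : c / 2 * u - c * u = - (c / 2 * u) by field.
by rewrite -[leLHS]mulrA -expRD e2.
Qed.

(** The moment formula at [c = 1] and [s = 2p - 1]; the bound on [p] is exactly [s >= 0]. *)
Lemma integrable_Gamma_integrand (p : R) : 2^-1 <= p ->
  mu.-integrable `]0, +oo[ (EFin \o Gamma_integrand p).
Proof.
move=> p2; have s0 : 0 <= 2 * p - 1 by lra.
have mG : measurable_fun (`](0 : R), +oo[%classic : set R) (EFin \o Gamma_integrand p).
  by apply/measurable_EFinP; apply: measurable_funTS; exact: measurable_Gamma_integrand.
apply/integrableP; split => //.
under eq_integral do rewrite gee0_abs ?lee_fin ?Gamma_integrand_ge0//.
have := @integral_gauss_weight _ 1 s0 ltr01.
rewrite subrK mulrAC divff// mul1r powR1 mul1e => <-.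
exact: integrable_lty (integrable_gauss_weight s0 ltr01).
Qed.

Lemma Rintegral_gauss_weight (s c : R) : 0 <= s -> 0 < c ->
  \int[mu]_t gauss_weight s c t = c `^ (- ((s + 1) / 2)) * Gamma ((s + 1) / 2).
Proof.
move=> s0 c0; rewrite /Rintegral integral_gauss_weight// fineM//.
by apply: integrable_fin_num => //; apply: integrable_Gamma_integrand; lra.
Qed.

Lemma Gamma_half : Gamma 2^-1 = Num.sqrt (pi : R).
Proof. by rewrite /Gamma /Rintegral integral_Gamma_integrand_half. Qed.

Let half_gt0 : (0 : R) < 2^-1. Proof. by rewrite invr_gt0. Qed.

(** The domination of powers, taken at [sqrt t] with exponent [2p] and [c = 1/2], gives
    [t^p <= K e^(t/2)]. *)
Lemma cvg_powRM_expRN_pinfty (p : R) : 0 <= p ->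
  t `^ p * expR (- t) @[t --> +oo] --> (0 : R).
Proof.
move=> p0; have p20 : 0 <= 2 * p by rewrite mulr_ge0.
have [K K0 pK] := norm_powR_le_expR_sqr p20 half_gt0.
apply: (@squeeze_cvgr _ _ _ _ (cst 0) (fun t => K * expR (- (t / 2)))).
- near=> t; have t0 : 0 <= t by near: t; exact: nbhs_pinfty_ge.
  rewrite mulr_ge0 ?powR_ge0 ?expR_ge0//=.
  have := pK (Num.sqrt t); rewrite ger0_norm ?sqrtr_ge0// powRrM.
  rewrite (powR_mulrn 2) ?sqrtr_ge0// sqr_sqrtr// => /(ler_wpM2r (expR_ge0 (- t))).
  by rewrite -mulrA -expRD (_ : 2^-1 * t - t = - (t / 2))//; field.
- exact: cvg_cst.
- rewrite -(mulr0 K); apply: cvgMr.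
  apply: (cvg_comp (fun t => t / 2) (fun t => expR (- t))); last exact: cvgr_expR.
  by apply: gt0_cvgMly.
Unshelve. all: by end_near. Qed.

(** The difference of the two sides is the integral of the derivative of [t^p e^(-t)], which
    vanishes at both ends. *)
Lemma GammaD1 (p : R) : 2^-1 <= p -> Gamma (p + 1) = p * Gamma p.
Proof.
move=> p2; have p0 : 0 < p by lra.
have ip := integrable_Gamma_integrand p2.
have ip1 : mu.-integrable `]0, +oo[ (EFin \o Gamma_integrand (p + 1)).
  by apply: integrable_Gamma_integrand; lra.
have pip : mu.-integrable `]0, +oo[ (EFin \o (fun t => p * Gamma_integrand p t)).
  by apply: eq_integrable (integrableZl _ p ip).
have bip : mu.-integrable `]0, +oo[
    (EFin \o (fun t => p * Gamma_integrand p t - Gamma_integrand (p + 1) t)).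
  by apply: eq_integrable (integrableB _ pip ip1).
apply/esym/eqP; rewrite -subr_eq0 /Gamma.
rewrite -RintegralZl// -RintegralB//.
(* Starting at 2 makes [(b n)^-1 < b n] strict already for [n = 0]. *)
apply/eqP; pose b n : R := n.+2%:R.
have b_lim : b n @[n --> \oo] --> +oo.
  rewrite (cvg_shiftS (fun n => n.+1%:R : R)) (cvg_shiftS (fun n => n%:R : R)).
  exact: cvgr_idn.
have b0 n : 0 < b n by [].
have a_lim : (b n)^-1 @[n --> \oo] --> (0 : R).
  by apply/gtr0_cvgV0; [exact: nearW|].
apply: (@Rintegral_FTC_exhaustion _ (fun n => (b n)^-1) b (fun t => t `^ p * expR (- t))) => //.
- by move=> n; rewrite (@lt_trans _ _ 1)// ?invf_lt1// ltr1n.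
- move=> n x /=; rewrite !in_itv/= andbT => /andP[+ _].
  by apply: lt_le_trans; rewrite invr_gt0.
- move=> x /=; rewrite in_itv/= andbT => x0; near=> n; apply/andP; split; near: n.
    exact: (cvgr_le _ a_lim).
  exact: (cvgry_ge b_lim).
- move=> x /=; rewrite in_itv/= andbT => x0.
  by apply: cvgB; [apply: cvgMr|]; exact: continuous_Gamma_integrand.
- by move=> x /=; rewrite in_itv/= andbT; exact: is_derive_powRM_expRN.
- rewrite -(subr0 0); apply: cvgB.
    exact: (cvg_comp b _ b_lim (cvg_powRM_expRN_pinfty (ltW p0))).
  rewrite -(mul0r (expR (- 0))); apply: cvgM; last first.
    apply: (cvg_comp _ expR); last exact: continuous_expR.
    exact: cvgN.
  (* The boundary term at 0 vanishes by continuity of [|t|^p] there, with value 0 because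
     [p > 0]. *)
  have : `|t| `^ p @[t --> (0:R)] --> `|0 : R| `^ p by exact/continuous_norm_powR/ltW.
  rewrite normr0 powR0 ?gt_eqF// => /(cvg_comp _ _ a_lim).
  apply: cvg_trans; apply: near_eq_cvg; apply: nearW => n /=.
  by rewrite gtr0_norm ?invr_gt0.
Unshelve. all: by end_near. Qed.

(** * Cosine transform of the Gaussian weights *)

Lemma rising_factorial_recr (a : R) k :
  rising_factorial a k.+1 = rising_factorial a k * (a + k%:R).
Proof. by rewrite /rising_factorial big_ord_recr. Qed.

Lemma rising_factorial_gt0 (a : R) k : 0 < a -> 0 < rising_factorial a k.
Proof. by move=> a0; apply: prodr_gt0 => i _; rewrite ltr_wpDr. Qed.

Lemma Gamma_rising (p : R) k : 2^-1 <= p ->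
  Gamma (p + k%:R) = rising_factorial p k * Gamma p.
Proof.
move=> p2; elim: k => [|k IH].
  by rewrite addr0 /rising_factorial big_ord0 mul1r.
rewrite -addn1 natrD addrA GammaD1; last by rewrite (le_trans p2)// lerDl.
by rewrite IH addn1 rising_factorial_recr; ring.
Qed.

(** This turns the factorials of the cosine series into the denominators [(1/2)_k k!] of the
    hypergeometric series; the [4 ^+ k] goes into its argument. *)
Lemma fact_double_rising k :
  (2 * k)`!%:R = 4 ^+ k * k`!%:R * rising_factorial (1 / 2) k :> R.
Proof.
elim: k => [|k IH].
  by rewrite muln0 fact0 /rising_factorial big_ord0 !mulr1.
rewrite mulnS addSn add1n !factS !natrM IH rising_factorial_recr exprS.
by rewrite -!natr1 natrM; field.
Qed.

(** In absolute value the cosine terms are the even-indexed terms of the exponential series at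
    [|y|]. Uniformity in [n] provides the dominating function for the termwise integration. *)
Lemma norm_series_cos_coeff' (y : R) n : `|series (cos_coeff' y) n| <= expR `|y|.
Proof.
apply: le_trans (_ : series (exp_coeff `|y|) n.*2 <= _); last first.
  apply: nondecreasing_cvgn_le; last exact: is_cvg_series_exp_coeff.
  by apply: nondecreasing_series => k _ _; rewrite exp_coeff_ge0.
rewrite /series/=; elim: n => [|n IH]; first by rewrite !big_geq// normr0.
rewrite big_nat_recr//= doubleS 2?big_nat_recr//=.
apply: (le_trans (ler_normD _ _)); rewrite -addrA lerD//.
apply: le_trans (_ : exp_coeff `|y| n.*2 <= _); last by rewrite lerDl exp_coeff_ge0.
rewrite /cos_coeff' /exp_coeff /= normrM normrM normrX.
by rewrite normrX normrN1 expr1n mul1r [X in _ * X]ger0_norm ?invr_ge0.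
Qed.

Lemma integral_sum_nat (h : nat -> R -> R) n :
  (forall k, mu.-integrable setT (EFin \o h k)) ->
  mu.-integrable setT (EFin \o (fun t => \sum_(0 <= k < n) h k t)) /\
  \int[mu]_t (\sum_(0 <= k < n) h k t) = \sum_(0 <= k < n) \int[mu]_t h k t.
Proof.
move=> hi; elim: n => [|n [IH1 IH2]].
  split; last first.
    by under eq_Rintegral do rewrite big_geq//; rewrite Rintegral_cst// mul0r big_geq.
  by apply: eq_integrable (integrable0 _ _) => // t _; rewrite /= big_geq.
have e : (fun t => \sum_(0 <= k < n.+1) h k t) = (fun t => \sum_(0 <= k < n) h k t + h n t).
  by apply/funext => t; rewrite big_nat_recr.
rewrite e big_nat_recr//= -IH2; split; last by rewrite RintegralD.
by apply: eq_integrable (integrableD _ IH1 (hi n)).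
Qed.

(** An even power does not see the sign of [t]. The case [k = 0] is apart because adding exponents
    at base 0 requires their sum to be nonzero. *)
Lemma gauss_weight_mul_even (s c t : R) k : 0 <= s ->
  gauss_weight s c t * t ^+ k.*2 = gauss_weight (s + k.*2%:R) c t.
Proof.
move=> s0; case: k => [|k]; first by rewrite expr0 addr0 mulr1.
rewrite /gauss_weight powRD; last by rewrite gt_eqF// ltr_wpDl// ltr0n.
rewrite powR_mulrn// -mul2n exprM exprM real_normK ?num_real//; ring.
Qed.

(** The cosine series is integrated term by term: the [k]-th term is a moment of order [s + 2k],
    hence a multiple of [Gamma (p + k)], which equals [(p)_k Gamma p]. *)
Lemma Rintegral_gauss_weight_cos (s c x : R) : 0 <= s -> 0 < c ->
  \int[mu]_t (gauss_weight s c t * cos (x * t)) =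
  c `^ (- ((s + 1) / 2)) * Gamma ((s + 1) / 2) *
  hypergeometric_1F1 ((s + 1) / 2) (1 / 2) (- (x ^+ 2 / (4 * c))).
Proof.
move=> s0 c0; set p := (s + 1) / 2; set C := _ * Gamma p.
have p2 : 2^-1 <= p by rewrite /p; lra.
have c20 : 0 < c / 2 by rewrite divr_gt0.
pose h k t := gauss_weight s c t * cos_coeff' (x * t) k.
have hE k : h k = fun t => (-1) ^+ k * x ^+ k.*2 / k.*2`!%:R *
    gauss_weight (s + k.*2%:R) c t.
  apply/funext => t; rewrite /h /cos_coeff' -gauss_weight_mul_even// exprMn -exprnP.
  by ring.
have sk0 k : 0 <= s + k.*2%:R :> R by rewrite addr_ge0.
have hi k : mu.-integrable setT (EFin \o h k).
  by rewrite hE; apply: eq_integrable (integrableZl _ _ (integrable_gauss_weight (sk0 k) c0)).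
have hint k : \int[mu]_t h k t = C * (rising_factorial p k /
    rising_factorial (1 / 2) k * ((- (x ^+ 2 / (4 * c))) ^+ k / k`!%:R)).
  rewrite hE RintegralZl//; last exact: integrable_gauss_weight.
  rewrite Rintegral_gauss_weight//.
  have -> : (s + k.*2%:R + 1) / 2 = p + k%:R by rewrite /p -mul2n natrM; field.
  have -> : c `^ (- (p + k%:R)) = c `^ (- p) * c ^- k.
    by rewrite opprD powRD ?(gt_eqF c0) ?implybT// powR_invn// ltW.
  rewrite Gamma_rising// /C.
  rewrite -mul2n fact_double_rising exprM.
  have -> : (- (x ^+ 2 / (4 * c))) ^+ k = (-1) ^+ k * x ^+ 2 ^+ k / (4 ^+ k * c ^+ k).
    by rewrite [LHS]exprNn [in LHS]expr_div_n (exprMn k 4 c) mulrA.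
  have r0 : rising_factorial (1 / 2) k != 0 :> R.
    by rewrite gt_eqF// rising_factorial_gt0// divr_gt0.
  have f0 : k`!%:R != 0 :> R by rewrite gt_eqF// ltr0n fact_gt0.
  have ck0 : c ^+ k != 0 by rewrite expf_neq0// gt_eqF.
  have fk0 : 4 ^+ k != 0 :> R by rewrite expf_neq0.
  by field; rewrite r0 f0 ck0 fk0.
have hsum n t : gauss_weight s c t * series (cos_coeff' (x * t)) n = \sum_(0 <= k < n) h k t.
  by rewrite /series/= mulr_sumr.
(* Completing the square: the difference of the exponents is [(|x| - c |t|)^2 / (2c)]. Half of the
   Gaussian remains to ensure integrability. *)
have exp_bound (t : R) : expR (- (c * t ^+ 2) + `|x * t|) <=
    expR (x ^+ 2 / (2 * c)) * expR (- (c / 2 * t ^+ 2)).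
  rewrite -expRD ler_expR -subr_ge0.
  have -> : x ^+ 2 / (2 * c) - c / 2 * t ^+ 2 - (- (c * t ^+ 2) + `|x * t|) =
      (`|x| - c * `|t|) ^+ 2 / (2 * c).
    rewrite -[x ^+ 2]real_normK ?num_real// -[t ^+ 2]real_normK ?num_real// normrM.
    by field; rewrite gt_eqF.
  by rewrite divr_ge0 ?sqr_ge0// mulr_ge0// ltW.
have mcos : measurable_fun setT (fun t => gauss_weight s c t * cos (x * t)).
  apply: measurable_funM; first exact: measurable_gauss_weight.
  apply: (measurableT_comp (continuous_measurable_fun (@continuous_cos R))).
  exact: mulrl_measurable.
have [] := @dominated_convergence _ _ _ mu setT measurableT
  (fun n => EFin \o (fun t => gauss_weight s c t * series (cos_coeff' (x * t)) n))
  (EFin \o (fun t => gauss_weight s c t * cos (x * t)))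
  (EFin \o (fun t => expR (x ^+ 2 / (2 * c)) * gauss_weight s (c / 2) t)).
- move=> n; have [/measurable_int + _] := integral_sum_nat n hi.
  by under [in X in _ -> X]eq_fun do rewrite /= hsum.
- exact/measurable_EFinP.
- apply: aeW => t _; apply: cvg_EFin; first exact: nearW.
  by apply: cvgMr; exact: cvg_cos_coeff'.
- exact: (integrableZl _ _ (integrable_gauss_weight s0 c20)).
- apply: aeW => t n _; rewrite lee_fin /= normrM ger0_norm ?gauss_weight_ge0//.
  apply: (le_trans (ler_wpM2l (gauss_weight_ge0 _ _ _) (norm_series_cos_coeff' _ _))).
  rewrite /gauss_weight [leRHS]mulrCA -[leLHS]mulrA ler_wpM2l ?powR_ge0//.
  by rewrite -expRD exp_bound.
move=> icos _ cvg_int.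
have {}cvg_int : C * series (fun k => rising_factorial p k /
    rising_factorial (1 / 2) k * ((- (x ^+ 2 / (4 * c))) ^+ k / k`!%:R)) n @[n --> \oo] -->
    \int[mu]_t (gauss_weight s c t * cos (x * t)).
  rewrite (_ : (fun n => _) =
      fun n => \int[mu]_t (gauss_weight s c t * series (cos_coeff' (x * t)) n)).
    by apply: fine_cvg; rewrite fineK//; exact: integrable_fin_num.
  apply/funext => n; under [RHS]eq_Rintegral do rewrite hsum.
  by rewrite (integral_sum_nat n hi).2 (eq_bigr _ (fun k _ => hint k)) -mulr_sumr.
(* Convergence of the hypergeometric series is obtained by dividing by [C]; if [C] were 0, both
   sides would be 0 whatever value [hypergeometric_1F1] takes. *)
have [C0|C0] := eqVneq C 0.
  rewrite C0 mul0r; apply: (cvg_unique _ cvg_int) => //.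
  rewrite C0 (_ : (fun n => _) = cst 0); first exact: cvg_cst.
  by apply/funext => n; rewrite mul0r.
rewrite -[LHS](mulVKf C0); congr (C * _); apply/esym/cvg_lim => //.
apply: cvg_trans (cvgMr (a := C^-1) cvg_int); apply: near_eq_cvg.
by apply: nearW => n; rewrite /= mulKf.
Qed.

(** * Fourier transform of the Hermite functions *)

Lemma hypergeometric_1F1_diag (a z : R) : 0 < a ->
  hypergeometric_1F1 a a z = expR z.
Proof.
move=> a0; rewrite /hypergeometric_1F1 /expR; congr (limn (series _)).
by apply/funext => k; rewrite divff ?mul1r// gt_eqF// rising_factorial_gt0.
Qed.

Lemma Rintegral_gauss_cos (x : R) :
  \int[mu]_t (gauss_fun t * cos (x * t)) = Num.sqrt pi * expR (- (x ^+ 2 / 4)).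
Proof.
have := @Rintegral_gauss_weight_cos 0 1 x (lexx _) ltr01.
rewrite add0r powR1 mul1r hypergeometric_1F1_diag ?divr_gt0// mulr1.
rewrite [in X in Gamma X]mul1r Gamma_half => <-.
by apply: eq_Rintegral => t _; rewrite /gauss_weight powRr0 !mul1r.
Qed.

Lemma deriv_hermite n : (hermite R n.+1)^`() = (2 * n.+1%:R)%:P * hermite R n.
Proof.
(* The recurrence reaches two indices back, so the induction carries two consecutive instances. *)
have [] : (hermite R n.+1)^`() = (2 * n.+1%:R)%:P * hermite R n /\
  (hermite R n.+2)^`() = (2 * n.+2%:R)%:P * hermite R n.+1; last by [].
elim: n => [|n [IH1 IH2]].
  by rewrite /= derivB !derivM !derivC derivX !polyCM -!natr1 !polyCD polyC0; split; ring.
split=> //.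
have -> : hermite R n.+3 = 2%:P * 'X * hermite R n.+2 - (2 * n.+2%:R)%:P * hermite R n.+1.
  by [].
rewrite derivB !derivM !derivC derivX IH1 IH2.
have -> : hermite R n.+2 = 2%:P * 'X * hermite R n.+1 - (2 * n.+1%:R)%:P * hermite R n by [].
by rewrite !polyCM -!natr1 !polyCD; ring.
Qed.

(** In this form the recurrence says that [e^(-y^2) H_(n+1)] is minus the derivative of
    [e^(-y^2) H_n], which is what integration by parts uses. *)
Lemma hermiteS n : hermite R n.+1 = 2%:P * 'X * hermite R n - (hermite R n)^`().
Proof.
case: n => [|n]; last by rewrite deriv_hermite.
by rewrite /= derivC subr0 mulr1.
Qed.

Lemma is_derive_gaussM_horner (p : {poly R}) (y : R) :
  is_derive y 1 (fun y => gauss_fun y * p.[y])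
    (gauss_fun y * (p^`() - 2%:P * 'X * p).[y]).
Proof.
have dp : is_derive y 1 (horner p) p^`().[y] by exact: is_derive_poly.
apply: is_derive_eq.
rewrite hornerD hornerN !hornerM hornerC hornerX /gauss_fun /GRing.scale/=; ring.
Qed.

Lemma integrable_gaussM_horner (p : {poly R}) :
  mu.-integrable setT (EFin \o (fun y => gauss_fun y * p.[y])).
Proof.
pose h k y := p`_k * (gauss_fun y * y ^+ k).
have e : (fun y => gauss_fun y * p.[y]) = (fun y => \sum_(0 <= k < size p) h k y).
  apply/funext => y; rewrite horner_coef big_mkord mulr_sumr.
  by apply: eq_bigr => i _; rewrite /h mulrCA.
rewrite e; apply: (integral_sum_nat _ _).1 => k.
suff ik : mu.-integrable setT (EFin \o (fun y => gauss_fun y * y ^+ k)).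
  by apply: eq_integrable (integrableZl _ p`_k ik).
apply: (le_integrable _ _ _ (integrable_gauss_weight (ler0n R k) ltr01)) => //.
- apply/measurable_EFinP; apply: measurable_funM; first exact: measurable_gauss_fun.
  exact: exprn_measurable.
- move=> y _; rewrite lee_fin /= !normrM normrX /gauss_weight powR_mulrn// mul1r mulrC.
  by rewrite normrX normr_id.
Qed.

(** For a monomial [y^k], put [t = y^2] in the decay of [t^(k/2) e^(-t)]; polynomials follow by
    linearity. *)
Lemma cvg_gaussM_horner_pinfty (p : {poly R}) :
  gauss_fun y * p.[y] @[y --> +oo] --> (0 : R).
Proof.
have mono k : gauss_fun y * y ^+ k @[y --> +oo] --> (0 : R).
  have k0 : 0 <= k%:R / 2 :> R by rewrite divr_ge0.
  have /(cvg_comp _ _ cvgr_expr2) := cvg_powRM_expRN_pinfty k0.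
  apply: cvg_trans; apply: near_eq_cvg; near=> y => /=.
  have y0 : 0 <= y by near: y; exact: nbhs_pinfty_ge.
  rewrite mulrC /gauss_fun; congr (_ * _).
  rewrite -(powR_mulrn 2 y0) -powRrM mulrCA divff// mulr1 powR_mulrn//.
have sum0 n : \sum_(0 <= i < n) p`_i * (gauss_fun y * y ^+ i) @[y --> +oo] --> (0 : R).
  elim: n => [|n IH].
    rewrite (_ : (fun _ => _) = cst 0); first exact: cvg_cst.
    by apply/funext => y; rewrite big_geq.
  rewrite (_ : (fun _ => _) = fun y =>
      \sum_(0 <= i < n) p`_i * (gauss_fun y * y ^+ i) + p`_n * (gauss_fun y * y ^+ n)).
    have := cvgD IH (cvgMr (a := p`_n) (mono n)); rewrite mulr0 addr0; apply.
  by apply/funext => y; rewrite big_nat_recr.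
apply: cvg_trans (sum0 (size p)); apply: near_eq_cvg; apply: nearW => y.
rewrite horner_coef big_mkord mulr_sumr.
by apply: eq_bigr => i _; rewrite mulrCA.
Unshelve. all: by end_near. Qed.

Lemma continuous_gaussM_horner_comp (q : {poly R}) (xi : R) (f : R -> R) :
  continuous f -> continuous (fun y => gauss_fun y * q.[y] * f (xi * y)).
Proof.
move=> cf y; apply: cvgM; last first.
  apply: (cvg_comp (fun y => xi * y) f); last exact: cf.
  exact: mulrl_continuous.
by apply: cvgM; [exact: continuous_gauss_fun|exact: continuous_horner].
Qed.

Lemma integrable_gaussM_horner_comp (q : {poly R}) (xi : R) (f : R -> R) :
  continuous f -> (forall t, `|f t| <= 1) ->
  mu.-integrable setT (EFin \o (fun y => gauss_fun y * q.[y] * f (xi * y))).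
Proof.
move=> cf f1; apply: (le_integrable _ _ _ (integrable_gaussM_horner q)) => //.
  apply/measurable_EFinP; apply: continuous_measurable_fun.
  exact: continuous_gaussM_horner_comp.
by move=> y _; rewrite lee_fin /= normrM ler_piMr.
Qed.

(** The primitive is [e^(-y^2) p(y) phi(xi y)], whose boundary terms vanish as [phi] is bounded.
    Keeping [phi] and [psi] abstract covers sine and cosine at once. *)
Lemma Rintegral_gaussM_horner_parts (p : {poly R}) (xi : R) (phi psi : R -> R) :
  (forall t : R, is_derive t 1 phi (psi t)) -> continuous psi ->
  (forall t, `|phi t| <= 1) -> (forall t, `|psi t| <= 1) ->
  \int[mu]_y (gauss_fun y * (2%:P * 'X * p - p^`()).[y] * phi (xi * y)) =
  xi * \int[mu]_y (gauss_fun y * p.[y] * psi (xi * y)).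
Proof.
move=> dphi cpsi phi1 psi1.
have cphi : continuous phi.
  by move=> t; exact: is_derive1_continuous (dphi t).
pose F y := gauss_fun y * p.[y] * phi (xi * y).
pose q := 2%:P * 'X * p - p^`().
pose f y := xi * (gauss_fun y * p.[y] * psi (xi * y)) - gauss_fun y * q.[y] * phi (xi * y).
have ip := integrable_gaussM_horner_comp p xi cpsi psi1.
have iq := integrable_gaussM_horner_comp q xi cphi phi1.
have ixp : mu.-integrable setT (EFin \o (fun y => xi * (gauss_fun y * p.[y] * psi (xi * y)))).
  by apply: eq_integrable (integrableZl _ xi ip).
apply/esym/eqP; rewrite -subr_eq0 -RintegralZl// -RintegralB//; apply/eqP.
pose b n : R := n.+1%:R.
have b_lim : b n @[n --> \oo] --> +oo.
  by rewrite (cvg_shiftS (fun n => n%:R : R)); exact: cvgr_idn.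
have lim0 (r : {poly R}) (h : R -> R) : (forall t, `|h t| <= 1) ->
    gauss_fun (b n) * r.[b n] * h (b n) @[n --> \oo] --> 0.
  move=> h1.
  have /cvg_norm := cvg_comp b _ b_lim (cvg_gaussM_horner_pinfty r).
  rewrite normr0 => rl; apply: (squeeze_cvgr _ _ rl); last first.
    by rewrite -oppr0; exact: cvgN rl.
  by apply: nearW => n /=; rewrite -ler_norml normrM ler_piMr.
have F0 : F (b n) @[n --> \oo] --> 0 by exact: (lim0 p (fun y => phi (xi * y))).
have FN0 : F (- b n) @[n --> \oo] --> 0.
  (* The limit at minus infinity is the limit at plus infinity for the reflected polynomial and the
     reflected [phi]. *)
  have := lim0 (p \Po - 'X) (fun y => phi (xi * - y)) (fun y => phi1 _).
  apply: cvg_trans; apply: near_eq_cvg; apply: nearW => n.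
  by rewrite /F /gauss_fun sqrrN horner_comp hornerN hornerX.
apply: (@Rintegral_FTC_exhaustion setT (fun n => - b n) b F f) => //.
- by apply: eq_integrable (integrableB _ ixp iq).
- by move=> n; rewrite (@lt_trans _ _ 0)// oppr_lt0.
- move=> x _; near=> n; rewrite -ler_norml; near: n; exact: (cvgry_ge b_lim).
- move=> x _; apply: cvgB; first apply: cvgMr; exact: continuous_gaussM_horner_comp.
- move=> x _; have dp := is_derive_gaussM_horner p x.
  have dx : is_derive x 1 (fun y => phi (xi * y)) (xi * psi (xi * x)).
    have dxi : is_derive x 1 (fun y => xi * y) xi.
      by apply: is_derive_eq; rewrite /GRing.scale/= mulr1.
    by have := is_derive1_comp (dphi (xi * x)) dxi; rewrite mulrC.
  apply: is_derive_eq; rewrite /f /q /GRing.scale/=.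
  rewrite !hornerD !hornerN; ring.
- by rewrite -(subr0 0); apply: cvgB.
Unshelve. all: by end_near. Qed.

Lemma Rintegral_hermiteSS (n : nat) (xi : R) (phi psi : R -> R) :
  (forall t : R, is_derive t 1 phi (psi t)) ->
  (forall t : R, is_derive t 1 psi (- phi t)) ->
  (forall t, `|phi t| <= 1) -> (forall t, `|psi t| <= 1) ->
  \int[mu]_y (gauss_fun y * (hermite R n.+2).[y] * phi (xi * y)) =
  - xi ^+ 2 * \int[mu]_y (gauss_fun y * (hermite R n).[y] * phi (xi * y)).
Proof.
move=> dphi dpsi phi1 psi1.
have cphi : continuous phi.
  by move=> t; exact: is_derive1_continuous (dphi t).
have cpsi : continuous psi.
  by move=> t; exact: is_derive1_continuous (dpsi t).
rewrite 2!hermiteS (Rintegral_gaussM_horner_parts _ _ dphi)//.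
have cNphi : continuous (fun t => - phi t) by move=> t; apply: cvgN; exact: cphi.
rewrite (Rintegral_gaussM_horner_parts _ _ dpsi)//; last by move=> t; rewrite normrN.
have -> : \int[mu]_y (gauss_fun y * (hermite R n).[y] * - phi (xi * y)) =
    - \int[mu]_y (gauss_fun y * (hermite R n).[y] * phi (xi * y)).
  rewrite -mulN1r -RintegralZl//; last exact: (integrable_gaussM_horner_comp _ _ cphi).
  by apply: eq_Rintegral => y _; rewrite mulrN mulN1r.
by rewrite mulrN mulrN mulrA -expr2 mulNr.
Qed.

Lemma Rintegral_hermite_cos (n : nat) (xi : R) :
  \int[mu]_y (gauss_fun y * (hermite R (2 * n)).[y] * cos (xi * y)) =
  (-1) ^+ n * xi ^+ (2 * n) * (Num.sqrt pi * expR (- (xi ^+ 2 / 4))).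
Proof.
elim: n => [|n IH].
  rewrite -Rintegral_gauss_cos !mul1r.
  by apply: eq_Rintegral => y _; rewrite /= hornerE mulr1.
rewrite mulnS add2n (@Rintegral_hermiteSS _ _ cos (fun t => - sin t)) ?IH.
- by rewrite !exprS; ring.
- by move=> t; rewrite ler_norml cos_geN1 cos_le1.
- by move=> t; rewrite normrN ler_norml sin_geN1 sin_le1.
Qed.

(** For [n = 0] the integrand is odd; the two-step recurrence, the same for sine as for cosine,
    propagates the vanishing. *)
Lemma Rintegral_hermite_sin (n : nat) (xi : R) :
  \int[mu]_y (gauss_fun y * (hermite R (2 * n)).[y] * sin (xi * y)) = 0.
Proof.
elim: n => [|n IH].
  rewrite muln0; apply: Rintegral_odd.
  - apply: (integrable_gaussM_horner_comp _ _ (@continuous_sin R)) => t.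
    by rewrite ler_norml sin_geN1 sin_le1.
  - exact: (@continuous_gaussM_horner_comp (hermite R 0) xi sin (@continuous_sin R)).
  - by move=> y; rewrite /gauss_fun sqrrN mulrN sinN mulrN /= !hornerE.
rewrite mulnS add2n (@Rintegral_hermiteSS _ _ sin cos) ?IH ?mulr0//.
- by move=> t; rewrite ler_norml sin_geN1 sin_le1.
- by move=> t; rewrite ler_norml cos_geN1 cos_le1.
Qed.

(** * From real trigonometric integrals to complex Fourier integrals *)

Lemma Cintegral_cis (f g : R -> R) :
  Cintegral (fun t => (f t)%:C * cis (g t)) =
  (\int[mu]_t (f t * cos (g t))) +i* (\int[mu]_t (f t * sin (g t))).
Proof.
rewrite /Cintegral; congr (_ +i* _); apply: eq_Rintegral => t _ /=.
  by rewrite mul0r subr0.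
by rewrite mul0r addr0.
Qed.

(** The sine part vanishes, so the transform is real. The [sqrt pi] of the Gaussian cancels against
    the normalization, of which [1 / sqrt 2] survives. *)
Lemma fourier_overscaled_hermite (n : nat) (xi : R) :
  fourier (fun y : R => (overscaled_hermite (2 * n)%N y)%:C) xi =
  ((-1) ^+ n / Num.sqrt 2 / Num.sqrt (2 ^+ (2 * n) * (2 * n)%N`!%:R) *
   (xi ^+ (2 * n) * expR (- (xi ^+ 2 / 4))))%:C.
Proof.
have overE y : overscaled_hermite (2 * n) y =
    (Num.sqrt (2 ^+ (2 * n) * (2 * n)%N`!%:R))^-1 * (gauss_fun y * (hermite R (2 * n)).[y]).
  by rewrite mulrA.
have integral_over (f : R -> R) : continuous f -> (forall t, `|f t| <= 1) ->
    \int[mu]_y (overscaled_hermite (2 * n) y * f (xi * y)) =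
    (Num.sqrt (2 ^+ (2 * n) * (2 * n)%N`!%:R))^-1 *
    \int[mu]_y (gauss_fun y * (hermite R (2 * n)).[y] * f (xi * y)).
  move=> cf f1; rewrite -RintegralZl//; last exact: (integrable_gaussM_horner_comp _ _ cf).
  by apply: eq_Rintegral => y _; rewrite overE mulrA.
rewrite /fourier Cintegral_cis.
rewrite (_ : \int[mu]_t _ = \int[mu]_t (overscaled_hermite (2 * n) t * cos (xi * t))); last first.
  by apply: eq_Rintegral => t _; rewrite cosN mulrC [t * xi]mulrC mulrC.
rewrite (_ : \int[mu]_t (_ * sin _) =
    \int[mu]_t (overscaled_hermite (2 * n) t * (fun y => - sin y) (xi * t))); last first.
  by apply: eq_Rintegral => t _; rewrite sinN mulrC [t * xi]mulrC mulrC.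
rewrite (integral_over cos (@continuous_cos R)); last first.
  by move=> t; rewrite ler_norml cos_geN1 cos_le1.
rewrite (_ : \int[mu]_t (overscaled_hermite (2 * n) t * - sin (xi * t)) = 0); last first.
  rewrite (integral_over (fun t => - sin t)); last 2 first.
  - by move=> t; apply: cvgN; exact: continuous_sin.
  - by move=> t; rewrite normrN ler_norml sin_geN1 sin_le1.
  rewrite (_ : \int[mu]_y _ = 0) ?mulr0// -oppr0 -(Rintegral_hermite_sin n xi).
  rewrite -mulN1r -RintegralZl//.
    by apply: eq_Rintegral => y _; rewrite mulrN mulN1r.
  apply: (@integrable_gaussM_horner_comp _ xi sin (@continuous_sin R)).
  by move=> t; rewrite ler_norml sin_geN1 sin_le1.
have s2p : Num.sqrt (2 * pi) = Num.sqrt 2 * Num.sqrt pi :> R by rewrite sqrtrM.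
rewrite Rintegral_hermite_cos s2p.
have sp0 : Num.sqrt pi != 0 :> R by rewrite sqrtr_eq0 -ltNge pi_gt0.
have s20 : Num.sqrt 2 != 0 :> R by rewrite sqrtr_eq0 -ltNge.
have sK0 : Num.sqrt (2 ^+ (2 * n) * (2 * n)%N`!%:R) != 0 :> R.
  by rewrite sqrtr_eq0 -ltNge mulr_gt0 ?exprn_gt0// ltr0n fact_gt0.
apply/eqP; rewrite eq_complex /= !mul0r !mulr0 subr0 addr0 eqxx andbT; apply/eqP.
by field; rewrite sp0 s20 sK0.
Qed.

Lemma continuous_gauss_weightM (s c x : R) (f : R -> R) : 0 <= s -> continuous f ->
  continuous (fun t => gauss_weight s c t * f (x * t)).
Proof.
move=> s0 cf t; apply: cvgM; first exact: continuous_gauss_weight.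
by apply: (cvg_comp (fun t => x * t) f); [exact: mulrl_continuous|exact: cf].
Qed.

Lemma integrable_gauss_weightM (s c x : R) (f : R -> R) : 0 <= s -> 0 < c ->
  continuous f -> (forall t, `|f t| <= 1) ->
  mu.-integrable setT (EFin \o (fun t => gauss_weight s c t * f (x * t))).
Proof.
move=> s0 c0 cf f1; apply: (le_integrable _ _ _ (integrable_gauss_weight s0 c0)) => //.
  apply/measurable_EFinP; apply: continuous_measurable_fun.
  exact: continuous_gauss_weightM.
by move=> t _; rewrite lee_fin /= normrM ler_piMr.
Qed.

Lemma Rintegral_gauss_weight_sin (s c x : R) : 0 <= s -> 0 < c ->
  \int[mu]_t (gauss_weight s c t * sin (x * t)) = 0.
Proof.
move=> s0 c0; apply: Rintegral_odd.
- apply: (integrable_gauss_weightM _ s0 c0 (@continuous_sin R)) => t.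
  by rewrite ler_norml sin_geN1 sin_le1.
- exact: (continuous_gauss_weightM s0 (@continuous_sin R)).
- by move=> t; rewrite gauss_weightN mulrN sinN mulrN.
Qed.

End overscaled_hermite_functions.

(** * The inverse transform and the explicit constant *)

Theorem theorem3p1 (R : realType) (alpha : R) (n : nat)
    (alpha_gt0 : 0 < alpha) (alpha_lt2 : alpha < 2) (x : R) :
  fractional_laplacian alpha
    (fun y : R => (overscaled_hermite (2 * n)%N y)%:C) x =
  (2 `^ alpha *
   ((-1) ^+ n * Num.sqrt ((2 * n)%N`!%:R) / (2 ^+ n * n`!%:R)) *
   (Gamma (n%:R + alpha / 2 + 1 / 2) / Gamma (n%:R + 1 / 2)) *
   hypergeometric_1F1 (n%:R + alpha / 2 + 1 / 2) (1 / 2) (- x ^+ 2))%:C.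
Proof.
set p := _ + 1 / 2.
set D : R := (-1) ^+ n / Num.sqrt 2 / Num.sqrt (2 ^+ (2 * n) * (2 * n)%N`!%:R).
(* The even power [xi^(2n)] of the transform merges with [|xi|^alpha]. The decay [e^(-xi^2/4)]
   imposes [c = 1/4], for which the argument [-x^2/(4c)] is just [-x^2]. *)
pose s : R := alpha + (2 * n)%:R.
have s0 : 0 <= s by rewrite addr_ge0// ltW.
have c0 : (0 : R) < 4^-1 by rewrite invr_gt0.
have sp : (s + 1) / 2 = p by rewrite /s /p natrM; field.
have weightE (xi : R) : (`|xi| `^ alpha)%:C *
    fourier (fun y : R => (overscaled_hermite (2 * n)%N y)%:C) xi * cis (x * xi) =
    (D * gauss_weight s 4^-1 xi)%:C * cis (x * xi).
  rewrite fourier_overscaled_hermite -/D -rmorphM /=; congr (_%:C * _).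
  rewrite /s mul2n -gauss_weight_mul_even ?ltW// /gauss_weight -mul2n.
  by rewrite [4^-1 * _]mulrC; ring.
rewrite /fractional_laplacian (funext weightE) Cintegral_cis.
rewrite (_ : \int[_]_t _ =
    D * \int[lebesgue_measure]_t (gauss_weight s 4^-1 t * cos (x * t))); last first.
  rewrite -RintegralZl//; last first.
    apply: (integrable_gauss_weightM _ s0 c0 (@continuous_cos R)) => t.
    by rewrite ler_norml cos_geN1 cos_le1.
  by apply: eq_Rintegral => t _; rewrite mulrA.
rewrite (_ : \int[_]_t (_ * sin _) = 0); last first.
  rewrite -(mulr0 D) -(Rintegral_gauss_weight_sin x s0 c0) -RintegralZl//; last first.
    apply: (integrable_gauss_weightM _ s0 c0 (@continuous_sin R)) => t.
    by rewrite ler_norml sin_geN1 sin_le1.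
  by apply: eq_Rintegral => t _; rewrite mulrA.
rewrite Rintegral_gauss_weight_cos// sp divff// divr1.
apply/eqP; rewrite eq_complex /= !mul0r !mulr0 subr0 addr0 eqxx andbT; apply/eqP.
(* Here [(1/4)^(-p) = 2^(2p)] and [2p = alpha + 2n + 1]. *)
have four_p : 4^-1 `^ (- p) = 2 `^ alpha * (2 * 2 ^+ n * 2 ^+ n).
  rewrite -[4^-1](powR_inv1 (ler0n R 4)) -powRrM mulN1r opprK.
  have -> : 4 = 2 `^ 2%:R :> R by rewrite powR_mulrn// -natrX.
  have -> : p = (alpha + (2 * n).+1%:R) / 2 by rewrite /p -[(2 * n).+1%:R]natr1 natrM; field.
  rewrite -powRrM mulrCA divff// mulr1 powRD; last by rewrite pnatr_eq0 implybT.
  by rewrite powR_mulrn// exprS mul2n -addnn exprD !mulrA.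
have Gamma_n : Gamma (n%:R + 1 / 2) = rising_factorial (1 / 2) n * Num.sqrt pi :> R.
  by rewrite addrC Gamma_rising ?mul1r ?Gamma_half.
have sqrt_K : Num.sqrt (2 ^+ (2 * n) * (2 * n)%N`!%:R) = 2 ^+ n * Num.sqrt (2 * n)%N`!%:R :> R.
  by rewrite sqrtrM ?exprn_ge0// mulnC exprM sqrtr_sqr ger0_norm ?exprn_ge0.
have r0 : rising_factorial (1 / 2) n != 0 :> R.
  by rewrite gt_eqF// rising_factorial_gt0// divr_gt0.
have sqr_S : Num.sqrt (2 * n)%N`!%:R ^+ 2 =
    2 ^+ n * 2 ^+ n * n`!%:R * rising_factorial (1 / 2) n :> R.
  by rewrite sqr_sqrtr ?ler0n// fact_double_rising -exprMn -natrM.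
have s2p : Num.sqrt (2 * pi) = Num.sqrt 2 * Num.sqrt pi :> R by rewrite sqrtrM.
have sqr_2 : Num.sqrt 2 ^+ 2 = 2 :> R by rewrite sqr_sqrtr.
have sp0 : Num.sqrt pi != 0 :> R by rewrite sqrtr_eq0 -ltNge pi_gt0.
have s20 : Num.sqrt 2 != 0 :> R by rewrite sqrtr_eq0 -ltNge.
have S0 : Num.sqrt (2 * n)%N`!%:R != 0 :> R by rewrite sqrtr_eq0 -ltNge ltr0n fact_gt0.
have p20 : 2 ^+ n != 0 :> R by rewrite expf_neq0.
rewrite /D four_p Gamma_n sqrt_K s2p.
(* To [field] the root of [(2n)!] is an opaque atom; expressing [n!] through its square lets the two
   cancel. *)
have -> : n`!%:R = Num.sqrt (2 * n)%N`!%:R ^+ 2 /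
    (2 ^+ n * 2 ^+ n * rising_factorial (1 / 2) n) :> R.
  by rewrite sqr_S; field; rewrite r0 p20.
(* The numerator [sqrt 2] cancels the [1 / sqrt 2] in [D], and the square, rewritten to 2, cancels
   the lone factor 2 of [four_p]. *)
have -> : (Num.sqrt 2 * Num.sqrt pi)^-1 = Num.sqrt 2 / Num.sqrt 2 ^+ 2 / Num.sqrt pi :> R.
  by field; rewrite s20 sp0.
by rewrite sqr_2; field; rewrite sp0 s20 S0 r0 p20.
Qed.
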